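(* Consider a seller who knows the mean $\mu$ of the valuation $X$, the upper bound $\beta$ on its support, and that its standard deviation lies in $[\underline\sigma,\bar\sigma]$, and let the optimal price be the maximizer over $p$ of the worst-case expected revenue $\tilde R(p)=\inf_{\mathbb{P}\in\mathcal{P}(\mu,\underline\sigma,\bar\sigma,\beta)}p\,\mathbb{P}(X\ge p)$. When the upper bound $\bar\sigma$ increases from the lower bound $\underline\sigma$ to the maximal value, the optimal price jumps from the low price $p^*_l(\bar\sigma)$ to a higher price, which is either $p^*_m(\beta)$ or $p^*_h(\underline\sigma,\beta)$, given that $\underline\sigma$ is sufficiently small.
   Context: $\mathcal{P}(\mu,\underline{\sigma},\bar{\sigma},\beta)$ is the set of all Borel probability distributions $\mathbb{P}$ of a random variable $X$ with $\mathbb{P}(X\in[0,\beta])=1$, $\mathbb{E}(X)=\mu$ and $\mathbb{E}(X^2)\in[\underline\sigma^2+\mu^2,\bar\sigma^2+\mu^2]$. The maximal value of the standard deviation of a distribution on $[0,\beta]$ with mean $\mu$ is $\sigma_{\max}=\sqrt{\mu(\beta-\mu)}$. Price functions: $p^*_h(\underline\sigma,\beta)=\beta-\sqrt{\beta\left(\beta-\mu-\underline\sigma^2/\mu\right)}$, $p^*_m(\beta)=\beta-\sqrt{\beta(\beta-\mu)}$, $p^*_l(\bar\sigma)=\mu-\bar\sigma\,\kappa(\mu,\bar\sigma)$, where (with real cube roots) $$\kappa(\mu,\bar\sigma)=\left(\tfrac{\mu}{\bar\sigma}+\sqrt{1+(\tfrac{\mu}{\bar\sigma})^2}\right)^{1/3}+\left(\tfrac{\mu}{\bar\sigma}-\sqrt{1+(\tfrac{\mu}{\bar\sigma})^2}\right)^{1/3}.$$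 *)

(* Defs.v *)
From HB Require Import structures.
From mathcomp Require Import all_boot all_order all_algebra.
From mathcomp Require Import all_classical all_reals all_analysis.
Set Implicit Arguments.
Unset Strict Implicit.
Unset Printing Implicit Defensive.
Import Order.TTheory GRing.Theory Num.Theory.
Import numFieldNormedType.Exports.
Local Open Scope classical_set_scope.
Local Open Scope ring_scope.

(* The valuation X is the identity random variable on R, so P is its law. *)
Definition ambiguity (R : realType) (mu slo shi beta : R)
    : set (probability (measurableTypeR R) R) :=
  [set P : probability (measurableTypeR R) R |
      [/\ P `[0, beta]%classic = 1%E,
          'E_P[(fun x : R => x)]%E = mu%:E,
          ((slo ^+ 2 + mu ^+ 2)%:E <= 'E_P[(fun x : R => x ^+ 2)%R])%E
        & ('E_P[(fun x : R => x ^+ 2)%R] <= (shi ^+ 2 + mu ^+ 2)%:E)%E]].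

(* The infimum is taken in \bar R: it is +oo on an empty ambiguity set. *)
Definition worst_revenue (R : realType) (mu slo shi beta p : R) : \bar R :=
  ereal_inf [set (p%:E * P `[p, +oo[%classic)%E |
    P in ambiguity mu slo shi beta].

Definition optimal_prices (R : realType) (mu slo shi beta : R) : set R :=
  [set p | forall q : R,
     (worst_revenue mu slo shi beta q <= worst_revenue mu slo shi beta p)%E].

Definition sigma_max (R : realType) (mu beta : R) : R :=
  Num.sqrt (mu * (beta - mu)).

(* Real cube root; powR alone is not the cube root at negative arguments. *)
Definition cbrt (R : realType) (x : R) : R := Num.sg x * (`|x| `^ (3%:R^-1)).

Definition kappa (R : realType) (mu shi : R) : R :=
  cbrt (mu / shi + Num.sqrt (1 + (mu / shi) ^+ 2)) +
  cbrt (mu / shi - Num.sqrt (1 + (mu / shi) ^+ 2)).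

Definition price_h (R : realType) (mu slo beta : R) : R :=
  beta - Num.sqrt (beta * (beta - mu - slo ^+ 2 / mu)).

Definition price_m (R : realType) (mu beta : R) : R :=
  beta - Num.sqrt (beta * (beta - mu)).

Definition price_l (R : realType) (mu shi : R) : R :=
  mu - shi * kappa mu shi.

(* Main.v *)
Require Import Defs.
From HB Require Import structures.
From mathcomp Require Import all_boot all_order all_algebra.
From mathcomp Require Import all_classical all_reals all_analysis.
From mathcomp Require Import measurable_realfun ring lra.
Import Order.TTheory GRing.Theory Num.Theory.
Import numFieldNormedType.Exports.
Local Open Scope classical_set_scope.
Local Open Scope ring_scope.

(* Every law P of the ambiguity set satisfies the mean bound
   P(X >= p) >= (mu - p) / (beta - p) and Cantelli's bound
   P(X >= p) >= (mu - p)^2 / (shi^2 + (mu - p)^2). Two-point laws with an atom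
   just below p show that the worst-case revenue at p is the larger of the two
   corresponding revenues for 0 < p <= mu - slo^2 / (beta - mu), while beyond that
   point the law on {mu - slo^2 / (beta - mu), beta} makes it O(slo^2).
   With z := shi * kappa, Cardano's formula gives
   z^3 + 3 shi^2 z = 2 mu shi^2, and the Cantelli revenue is maximal exactly at
   mu - z, with value mu - 3 z / 2, which decreases in shi. The mean revenue is
   maximal exactly at price_m, with a value 2 price_m - mu that does not depend
   on shi. The jump occurs where the two values cross, and for small slo the
   price after the jump is always price_m. *)

(** * Cube roots and Cardano's cubic *)

Lemma cbrtK {R : realType} (x : R) : cbrt x ^+ 3 = x.
Proof.
rewrite /cbrt exprMn -(powR_mulrn _ (powR_ge0 _ _))// -powRrM mulVf// powRr1//.
by case: sgrP => [->|_|_]; rewrite ?mul1r ?expr1n//; ring.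
Qed.

(** Cardano: the cube roots [u] and [v] satisfy [u^3 + v^3 = 2 t] and [u v = -1], hence
    [(u + v)^3 + 3 (u + v) = 2 t], which is then scaled by [s]. *)
Lemma kappa_cubic {R : realType} {mu s : R} : s != 0 ->
  (s * kappa mu s) ^+ 3 + 3 * s ^+ 2 * (s * kappa mu s) = 2 * mu * s ^+ 2.
Proof.
move=> s0; rewrite /kappa; set t := mu / s.
set r := Num.sqrt _; have r2 : r ^+ 2 = 1 + t ^+ 2.
  by rewrite sqr_sqrtr// addr_ge0// sqr_ge0.
have u3 := cbrtK (t + r); have v3 := cbrtK (t - r).
set u := cbrt _ in u3 *; set v := cbrt _ in v3 *.
(* With [w = u v], one has [w^3 = t^2 - r^2 = -1], and the cofactor of [w + 1] in [w^3 + 1] is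
   positive. *)
have /eqP : (u * v + 1) * ((u * v - 2^-1) ^+ 2 + 3 / 4) = 0.
  have -> : (u * v + 1) * ((u * v - 2^-1) ^+ 2 + 3 / 4) = u ^+ 3 * v ^+ 3 + 1.
    by field.
  by rewrite u3 v3; ring: r2.
rewrite mulf_eq0 [X in _ || X]gt_eqF ?orbF; last first.
  by rewrite ltr_wpDl ?sqr_ge0// divr_gt0.
move=> /eqP uv.
have -> : mu = t * s by rewrite /t divfK.
have -> : (s * (u + v)) ^+ 3 + 3 * s ^+ 2 * (s * (u + v)) =
    s ^+ 3 * (u ^+ 3 + v ^+ 3) + 3 * s ^+ 3 * (u * v + 1) * (u + v) by ring.
by rewrite u3 v3 uv; ring.
Qed.

(** * Moment bounds and two-point laws *)

(** Weak duality for the moment problem: a quadratic lying below the indicator of [[p, +oo[] on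
    [[0, beta]] is integrated. The witness [m] is the second moment of [P]. *)
Lemma ambiguity_quadratic_le {R : realType} {mu slo shi beta p a b c : R}
    {P : probability (measurableTypeR R) R} :
  ambiguity mu slo shi beta P ->
  (forall x : R, 0 <= x <= beta -> a + b * x + c * x ^+ 2 <= (p <= x)%R%:R) ->
  exists2 m : R, m <= shi ^+ 2 + mu ^+ 2 &
    ((a + b * mu + c * m)%:E <= P `[p, +oo[%classic)%E.
Proof.
case; rewrite !unlock => P1 EX _ EX2 le_ind.
pose X1 (x : measurableTypeR R) : \bar R := (x : R)%:E.
pose X2 (x : measurableTypeR R) : \bar R := ((x : R) ^+ 2)%:E.
have mX1 : measurable_fun setT X1 by exact/measurable_EFinP.
have mX2 : measurable_fun setT X2.
  by apply/measurable_EFinP; exact: measurable_funX.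
have iX2 : P.-integrable setT X2.
  apply/integrableP; split => //.
  rewrite (eq_integral X2) ?(le_lt_trans EX2) ?ltry//.
  by move=> x _; rewrite gee0_abs// lee_fin sqr_ge0.
have icst k : P.-integrable setT (fun=> k%:E).
  exact: finite_measure_integrable_cst.
(* Since [|x| <= 1 + x^2], integrability passes from the square to [x]. *)
have iX1 : P.-integrable setT X1.
  apply: (le_integrable _ mX1 _ (integrableD measurableT (icst 1) iX2)) => //.
  move=> x _; rewrite lee_fin [leRHS]ger0_norm ?addr_ge0 ?sqr_ge0//.
  by rewrite -[x ^+ 2]real_normK ?num_real//; nra.
have fX2 := integrable_fin_num measurableT iX2.
exists (fine (\int[P]_x X2 x)%E); first by rewrite -lee_fin fineK.
have ibX1 : P.-integrable setT (fun x => b%:E * X1 x)%E.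
  exact: integrableZl.
have icX2 : P.-integrable setT (fun x => c%:E * X2 x)%E.
  exact: integrableZl.
have iabX1 : P.-integrable setT (fun x => a%:E + b%:E * X1 x)%E.
  exact: integrableD.
pose q x := (a%:E + b%:E * X1 x + c%:E * X2 x)%E.
have iq : P.-integrable setT q by exact: integrableD.
have -> : (a + b * mu + c * fine (\int[P]_x X2 x))%:E = (\int[P]_x q x)%E.
  rewrite integralD// integralD// !integralZl// integral_cst//.
  rewrite -[in RHS](fineK fX2) [X in (a%:E * X)%E](_ : _ = 1%E).
    by rewrite mule1 [X in (b%:E * X)%E](_ : _ = mu%:E).
  exact: probability_setT.
(* The quadratic is controlled only on [[0, beta]], so the null set [N] is removed from both
   integrals. *)
pose N : set (measurableTypeR R) := ~` `[0, beta]%classic.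
have mN : measurable N by exact: measurableC.
have PN : P N = 0%E by rewrite probability_setC// P1 subee.
have iind : P.-integrable setT (EFin \o \1_(`[p, +oo[%classic)).
  exact: integrable_indic.
rewrite -[`[p, +oo[%classic]setIT -integral_indic//.
rewrite (negligible_integral mN)// [leRHS](negligible_integral mN)//.
have mDN := measurableD (measurableT : measurable [set: measurableTypeR R]) mN.
apply: le_integral => //.
- exact: (integrableS measurableT mDN _ iq).
- exact: (integrableS measurableT mDN _ iind).
move=> x; rewrite inE => -[_] /contrapT /=; rewrite in_itv/= => x0b.
rewrite lee_fin indicE mem_setE in_itv/= andbT; exact: le_ind.
Qed.

Lemma two_point_law {R : realType} (a b w : R) : 0 <= w <= 1 ->
  exists P : probability (measurableTypeR R) R,
    (forall A : set (measurableTypeR R), measurable A ->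
       P A = (w * \1_A b + (1 - w) * \1_A a)%:E) /\
    (forall f : R -> R, measurable_fun setT f -> 0 <= f a -> 0 <= f b ->
       'E_P[f]%E = (w * f b + (1 - w) * f a)%:E).
Proof.
move=> w01; pose g (t : bool) : measurableTypeR R := if t then b else a.
have mg : measurable_fun setT g by [].
pose X : {mfun bool >-> measurableTypeR R} := mfun_Sub (mem_set mg).
exists (distribution (bernoulli_prob w) X); split => [A mA|f mf fa fb].
  rewrite /= /distribution /pushforward bernoulli_probE//.
have EfX (h : R -> R) : 0 <= h a -> 0 <= h b ->
    (\int[bernoulli_prob w]_y (h (X y))%:E)%E = (w * h b + (1 - w) * h a)%:E.
  move=> ha hb; rewrite integral_bernoulli_prob//= => x.
  by rewrite lee_fin; case: x.
rewrite unlock integral_distribution ?EfX//; first exact/measurable_EFinP.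
apply/integrableP; split => //=.
by rewrite (EfX (fun x => `|f x|))// ltry.
Qed.

(** The weight [(mu - a) / (b - a)] at [b] gives mean [mu] and variance [(mu - a) * (b - mu)], so
    the law on [a] and [b] is admissible. *)
Lemma worst_revenue_two_point {R : realType} {mu slo shi beta a b q : R} :
  0 <= a -> a <= mu -> mu <= b -> a < b -> b <= beta ->
  slo ^+ 2 <= (mu - a) * (b - mu) -> (mu - a) * (b - mu) <= shi ^+ 2 ->
  a < q \/ q <= 0 ->
  (worst_revenue mu slo shi beta q <=
     (q * ((mu - a) / (b - a) * (q <= b)%R%:R))%:E)%E.
Proof.
move=> a0 amu mub ab bbeta lo hi q_range.
have ba : b - a != 0 by rewrite subr_eq0 gt_eqF.
have ba0 : 0 < b - a by rewrite subr_gt0.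
pose w := (mu - a) / (b - a).
have w01 : 0 <= w <= 1.
  by rewrite divr_ge0 ?subr_ge0 ?(ltW ab)//= ler_pdivrMr// mul1r lerD2r.
have [P [PA EP]] := two_point_law a b w w01.
apply: ge_ereal_inf; exists (q%:E * P `[q, +oo[%classic)%E.
  exists P => //; split.
  - rewrite PA// !indicE !mem_setE !in_itv/= a0 bbeta (le_trans a0 (ltW ab)).
    by rewrite (le_trans (ltW ab) bbeta) !mulr1 addrC subrK.
  - rewrite EP ?(le_trans a0 (ltW ab))//; congr EFin.
    by rewrite /w; field.
  - rewrite EP ?sqr_ge0//.
    rewrite lee_fin (_ : _ + (1 - w) * _ = mu ^+ 2 + (mu - a) * (b - mu)).
      by rewrite addrC lerD2l.
    by rewrite /w; field.
  - rewrite EP ?sqr_ge0//.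
    rewrite lee_fin (_ : _ + (1 - w) * _ = mu ^+ 2 + (mu - a) * (b - mu)).
      by rewrite addrC lerD2r.
    by rewrite /w; field.
rewrite PA// -EFinM lee_fin !indicE !mem_setE !in_itv/= !andbT -/w.
case: q_range => [aq|q0]; first by rewrite (leNgt q a) aq/= mulr0 addr0.
(* For [q <= 0], dropping the atom [a] can only raise the product. *)
apply: ler_wnM2l => //; rewrite lerDl mulr_ge0 ?ler0n// subr_ge0.
by case/andP: w01.
Qed.

(* The quadratic of the second bound touches the indicator at p and at
   mu + shi ^+ 2 / (mu - p), the support of the extremal law. *)
Lemma ambiguity_tail_ge {R : realType} {mu slo shi beta p : R}
    {P : probability (measurableTypeR R) R} :
  p < mu -> mu < beta -> 0 < shi -> ambiguity mu slo shi beta P ->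
  (((mu - p) / (beta - p))%:E <= P `[p, +oo[%classic)%E /\
  (((mu - p) ^+ 2 / (shi ^+ 2 + (mu - p) ^+ 2))%:E <= P `[p, +oo[%classic)%E.
Proof.
move=> pmu mub s0 PA; split.
  have bp : 0 < beta - p by rewrite subr_gt0 (lt_trans pmu).
  (* This affine function is [(x - p) / (beta - p)]: 0 at [p] and 1 at [beta]. *)
  have le_ind x : 0 <= x <= beta ->
      - p / (beta - p) + (beta - p)^-1 * x + 0 * x ^+ 2 <= (p <= x)%R%:R.
    move=> /andP[x0 xb]; rewrite mul0r addr0 [_^-1 * x]mulrC -mulrDl.
    by rewrite ler_pdivrMr//; case: (leP p x) => /= px; lra.
  have [m _] := ambiguity_quadratic_le PA le_ind.
  by rewrite mul0r addr0 [_^-1 * mu]mulrC -mulrDl [- p + _]addrC.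
pose y := mu - p; have y0 : 0 < y by rewrite subr_gt0.
pose v := shi ^+ 2; have v0 : 0 < v by rewrite exprn_gt0.
pose t := mu + v / y; pose k := (y / (y ^+ 2 + v)) ^+ 2.
have k0 : 0 <= k by rewrite sqr_ge0.
have D0 : y ^+ 2 + v != 0 by rewrite gt_eqF// addr_gt0// exprn_gt0.
have tp : k * (t - p) ^+ 2 = 1.
  rewrite /k /t (_ : mu + v / y - p = (y ^+ 2 + v) / y).
    by field; rewrite D0 gt_eqF.
  by rewrite /y; field; rewrite -/y gt_eqF.
have le_ind x : 0 <= x <= beta ->
    1 - k * t ^+ 2 + 2 * k * t * x + - k * x ^+ 2 <= (p <= x)%R%:R.
  move=> _.
  have -> : 1 - k * t ^+ 2 + 2 * k * t * x + - k * x ^+ 2 =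
    1 - k * (t - x) ^+ 2 by ring.
  case: (leP p x) => /= px; first by rewrite gerBl mulr_ge0// sqr_ge0.
  rewrite -tp -mulrBr; apply: mulr_ge0_le0 => //.
  have tp0 : 0 < t - p by rewrite /t addrAC addr_gt0// divr_gt0.
  rewrite subr_le0; nra.
have [m mle] := ambiguity_quadratic_le PA le_ind.
apply: le_trans; rewrite lee_fin -/y -/v.
have -> : y ^+ 2 / (v + y ^+ 2) =
    1 - k * t ^+ 2 + 2 * k * t * mu + - k * (v + mu ^+ 2).
  by rewrite /k /t; field; rewrite D0 gt_eqF// addrC D0.
(* Since [- k <= 0], the second moment may be replaced by its upper bound. *)
by rewrite lerD2l !mulNr lerN2 ler_wpM2l.
Qed.

(** An atom exactly at the price [q] would count as a sale; continuity lets it move slightly below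
    [q] while the revenue stays under [K]. *)
Lemma continuous_lt_left {R : realType} {f : R -> R} {q lo K : R} :
  {for q, continuous f} -> f q < K -> lo < q ->
  exists2 a, lo < a < q & f a < K.
Proof.
move=> cf fqK loq.
have [a [aq loa faK]] : exists a, [/\ a < q, lo < a & f a < K].
  apply: (@filter_ex _ (q^'-)); near=> a; split; near: a.
  - exact: nbhs_left_lt.
  - exact: nbhs_left_gt.
  - by apply: (cvgr_lt (f q)) => //; exact: cvg_at_left_filter.
by exists a => //; rewrite loa.
Unshelve. all: by end_near. Qed.

(** Each [q] is met by a two-point law: on [e] and [beta] if [q <= 0] or [e < q], of variance
    [shi^2] if [0 < q <= l], and on [beta] and some [a < q] in between. *)
Lemma worst_revenue_lt {R : realType} {mu slo shi beta K q : R} :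
  0 < mu -> mu < beta -> 0 <= slo -> slo <= shi -> 0 < shi ->
  shi ^+ 2 <= mu * (beta - mu) -> 0 < K ->
  beta * (slo / (beta - mu)) ^+ 2 < K ->
  (0 < q -> q < mu ->
    q * ((mu - q) ^+ 2 / (shi ^+ 2 + (mu - q) ^+ 2)) < K) ->
  (0 < q -> q < beta -> q * ((mu - q) / (beta - q)) < K) ->
  (worst_revenue mu slo shi beta q < K%:E)%E.
Proof.
move=> mu0 mub slo0 sloshi shi0 shimax K0 loK lowK midK.
have bmu : 0 < beta - mu by rewrite subr_gt0.
have bmuN0 : beta - mu != 0 by rewrite gt_eqF.
have slo2 : slo ^+ 2 <= shi ^+ 2 by rewrite lerXn2r// nnegrE// ltW.
(* [e] is the lower atom for which the law on [e] and [beta] has variance [slo^2], the smallest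
   allowed. *)
pose e := mu - slo ^+ 2 / (beta - mu).
have emu : e <= mu by rewrite gerBl divr_ge0 ?sqr_ge0// ltW.
have e0 : 0 <= e by rewrite subr_ge0 ler_pdivrMr// (le_trans slo2).
have evar : (mu - e) * (beta - mu) = slo ^+ 2.
  by rewrite /e opprB addrC subrK divfK.
have eb : e < beta by exact: le_lt_trans emu mub.
have e_law : e < q \/ q <= 0 -> (worst_revenue mu slo shi beta q < K%:E)%E.
  move=> eq; apply: le_lt_trans (worst_revenue_two_point e0 emu (ltW mub) eb
    (lexx beta) _ _ eq) _; rewrite ?evar// lte_fin.
  have be : 0 < beta - e by rewrite subr_gt0.
  have [qb|] := leP q beta; last by rewrite !mulr0.
  rewrite mulr1; apply: le_lt_trans loK.
  have w0 : 0 <= (mu - e) / (beta - e) by rewrite divr_ge0 ?subr_ge0// ltW.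
  (* Enlarging [q] to [beta], then shrinking [beta - e] to [beta - mu], leaves exactly the quantity
     bounded by [loK]. *)
  apply: (le_trans (ler_wpM2r w0 qb)).
  rewrite ler_pM2l; last exact: lt_trans mub.
  have -> : (slo / (beta - mu)) ^+ 2 = (mu - e) / (beta - mu).
    by rewrite expr_div_n -evar; field.
  by rewrite ler_wpM2l ?subr_ge0// lef_pV2 ?posrE// lerD2l lerN2.
have [q0|q0] := leP q 0; first by apply: e_law; right.
have [eq|qe] := ltP e q; first by apply: e_law; left.
have qmu : q <= mu by exact: le_trans qe emu.
have qb : q < beta by exact: le_lt_trans qmu mub.
(* [l] is the lower atom that, paired with [beta], gives variance [shi^2]. For [a <= l] the Cantelli
   partner [mu + shi^2 / (mu - a)] stays below or at [beta]; for [a > l] the law on [a] and [beta]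
   has variance below [shi^2]. *)
pose l := mu - shi ^+ 2 / (beta - mu).
have [ql|lq] := leP q l.
- have qltmu : q < mu.
    by apply: le_lt_trans ql _; rewrite gtrBl divr_gt0// exprn_gt0.
  pose f a := q * ((mu - a) ^+ 2 / (shi ^+ 2 + (mu - a) ^+ 2)).
  have cf : {for q, continuous f}.
    have cB : mu - a @[a --> q] --> mu - q.
      by apply: cvgB; [exact: cvg_cst|exact: cvg_id].
    have cB2 : (mu - a) ^+ 2 @[a --> q] --> (mu - q) ^+ 2.
      by rewrite expr2; under eq_cvg do rewrite expr2; exact: cvgM.
    apply: cvgM; first exact: cvg_cst.
    apply: cvgM => //; apply: cvgV; last by apply: cvgD => //; exact: cvg_cst.
    by rewrite gt_eqF// ltr_wpDr ?sqr_ge0// exprn_gt0.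
  have [a /andP[a0 aq] faK] := continuous_lt_left cf (lowK q0 qltmu) q0.
  have amu : a < mu by exact: lt_le_trans aq qmu.
  have y0 : 0 < mu - a by rewrite subr_gt0.
  pose b := mu + shi ^+ 2 / (mu - a).
  have mb : mu < b by rewrite ltrDl divr_gt0// exprn_gt0.
  have bbeta : b <= beta.
    rewrite /b addrC -lerBrDr ler_pdivrMr// mulrC -ler_pdivrMr//.
    by rewrite lerBrDl -lerBrDr; apply: le_trans ql; exact: ltW.
  have bvar : (mu - a) * (b - mu) = shi ^+ 2.
    by rewrite /b [mu + _ - mu]addrAC subrr add0r mulrC divfK// gt_eqF.
  apply: le_lt_trans (worst_revenue_two_point (ltW a0) (ltW amu) (ltW mb)
    (lt_trans amu mb) bbeta _ _ (or_introl aq)) _; rewrite ?bvar//.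
  rewrite lte_fin (ltW (le_lt_trans qmu mb)) mulr1.
  suff -> : (mu - a) / (b - a) =
    (mu - a) ^+ 2 / (shi ^+ 2 + (mu - a) ^+ 2) by [].
  rewrite -bvar; field; rewrite bvar subr_eq0 !gt_eqF ?(lt_trans amu mb)//.
  by rewrite addr_gt0// exprn_gt0.
- pose f a := q * ((mu - a) / (beta - a)).
  have cf : {for q, continuous f}.
    apply: cvgM; first exact: cvg_cst.
    apply: cvgM; first by apply: cvgB; [exact: cvg_cst|exact: cvg_id].
    apply: cvgV; last by apply: cvgB; [exact: cvg_cst|exact: cvg_id].
    by rewrite subr_eq0 gt_eqF.
  have mq : Num.max 0 l < q by rewrite gt_max q0.
  have [a /andP[ma aq] faK] := continuous_lt_left cf (midK q0 qb) mq.
  move: ma; rewrite gt_max => /andP[a0 la].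
  have amu : a < mu by exact: lt_le_trans aq qmu.
  apply: le_lt_trans (worst_revenue_two_point (ltW a0) (ltW amu) (ltW mub)
    (lt_trans amu mub) (lexx beta) _ _ (or_introl aq)) _.
  + by rewrite -evar ler_pM2r// lerD2l lerN2 (ltW (lt_le_trans aq qe)).
  + by rewrite -ler_pdivlMr// lerBlDr -lerBlDl ltW.
  + by rewrite lte_fin (ltW qb) mulr1.
Qed.

(** * Maxima of the Cantelli and mean revenues *)

(** Here [y] stands for [mu - p]. The cubic is the first-order condition at [z], so the cleared
    difference has the double root [y = z], with positive cofactor [z + 2 y] up to a constant. *)
Lemma low_revenue_lt {R : realType} {mu s y z : R} : 0 < s -> 0 < z ->
  z ^+ 3 + 3 * s ^+ 2 * z = 2 * mu * s ^+ 2 -> 0 < y -> y != z ->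
  (mu - y) * (y ^+ 2 / (s ^+ 2 + y ^+ 2)) < mu - 3 / 2 * z.
Proof.
move=> s0 z0 cubic y0 yz.
have s20 : 0 < s ^+ 2 by rewrite exprn_gt0.
have d0 : 0 < s ^+ 2 + y ^+ 2 by rewrite addr_gt0// exprn_gt0.
rewrite mulrA ltr_pdivrMr// -(ltr_pM2l (_ : 0 < 2 * s ^+ 2)) ?mulr_gt0//.
rewrite -subr_gt0.
have -> : 2 * s ^+ 2 * ((mu - 3 / 2 * z) * (s ^+ 2 + y ^+ 2)) -
    2 * s ^+ 2 * ((mu - y) * y ^+ 2) = s ^+ 2 * ((y - z) ^+ 2 * (z + 2 * y)) +
    s ^+ 2 * (2 * mu * s ^+ 2 - (z ^+ 3 + 3 * s ^+ 2 * z)).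
  by field.
have yz2 : 0 < (y - z) ^+ 2 by rewrite exprn_even_gt0//= subr_eq0.
have zy : 0 < z + 2 * y by rewrite addr_gt0 ?mulr_gt0.
rewrite cubic subrr mulr0 addr0.
by apply: mulr_gt0 => //; exact: mulr_gt0.
Qed.

Lemma low_revenue_eq {R : realType} {mu s z : R} : 0 < s ->
  z ^+ 3 + 3 * s ^+ 2 * z = 2 * mu * s ^+ 2 ->
  (mu - z) * (z ^+ 2 / (s ^+ 2 + z ^+ 2)) = mu - 3 / 2 * z.
Proof.
move=> s0 cubic.
have s20 : 0 < s ^+ 2 by rewrite exprn_gt0.
have d0 : s ^+ 2 + z ^+ 2 != 0 by rewrite gt_eqF// ltr_wpDr ?sqr_ge0.
apply: (mulfI d0); rewrite mulrCA [_ * (z ^+ 2 / _)]mulrC divfK//.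
apply: (mulfI (_ : 2 * s ^+ 2 != 0)); first by rewrite mulf_neq0// gt_eqF.
apply/eqP; rewrite -subr_eq0; apply/eqP.
have -> : 2 * s ^+ 2 * ((mu - z) * z ^+ 2) -
    2 * s ^+ 2 * ((s ^+ 2 + z ^+ 2) * (mu - 3 / 2 * z)) =
    s ^+ 2 * (z ^+ 3 + 3 * s ^+ 2 * z - 2 * mu * s ^+ 2) by field.
by rewrite cubic subrr mulr0.
Qed.

(** In the form [z^3 = s^2 (2 mu - 3 z)], the right side decreases in [z] and, where positive,
    increases in [s]; so [z2 <= z1] would force [z1^3 < z2^3]. *)
Lemma cardano_root_lt {R : realType} {mu s1 s2 z1 z2 : R} :
  0 < s1 -> s1 < s2 -> 0 < z2 ->
  z1 ^+ 3 + 3 * s1 ^+ 2 * z1 = 2 * mu * s1 ^+ 2 ->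
  z2 ^+ 3 + 3 * s2 ^+ 2 * z2 = 2 * mu * s2 ^+ 2 -> z1 < z2.
Proof.
move=> s10 s12 z20 c1 c2; rewrite ltNge; apply/negP => z21.
have s20 : 0 < s2 ^+ 2 by rewrite exprn_gt0// (lt_trans s10).
have s122 : s1 ^+ 2 < s2 ^+ 2.
  by rewrite ltr_pXn2r// nnegrE ltW// (lt_trans s10).
have cubeE (s z : R) : z ^+ 3 + 3 * s ^+ 2 * z = 2 * mu * s ^+ 2 ->
    z ^+ 3 = s ^+ 2 * (2 * mu - 3 * z).
  move=> c; have -> : s ^+ 2 * (2 * mu - 3 * z) =
    2 * mu * s ^+ 2 - 3 * s ^+ 2 * z by ring.
  by rewrite -c addrK.
have e1 := cubeE _ _ c1; have e2 := cubeE _ _ c2.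
have z2p : 0 < 2 * mu - 3 * z2.
  by rewrite -(pmulr_rgt0 _ s20) -e2 exprn_gt0.
have z321 : z2 ^+ 3 <= z1 ^+ 3.
  by rewrite lerXn2r// nnegrE ltW// (lt_le_trans z20).
suff : z1 ^+ 3 < z2 ^+ 3 by rewrite ltNge z321.
rewrite e1 e2.
have : s1 ^+ 2 * (2 * mu - 3 * z1) <= s1 ^+ 2 * (2 * mu - 3 * z2).
  by rewrite ler_wpM2l ?sqr_ge0//; lra.
by move=> /le_lt_trans; apply; rewrite ltr_pM2r.
Qed.

(** The cubics differ by [z1 - z2] times a sum of squares plus [3 s^2]. This serves to identify
    [s * kappa mu s] with a root chosen in advance. *)
Lemma cardano_root_inj {R : realType} {mu s z1 z2 : R} : 0 < s ->
  z1 ^+ 3 + 3 * s ^+ 2 * z1 = 2 * mu * s ^+ 2 ->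
  z2 ^+ 3 + 3 * s ^+ 2 * z2 = 2 * mu * s ^+ 2 -> z1 = z2.
Proof.
move=> s0 c1 c2; apply/eqP; rewrite -subr_eq0.
have : (z1 - z2) * ((z1 + z2 / 2) ^+ 2 + 3 / 4 * z2 ^+ 2 + 3 * s ^+ 2) == 0.
  have -> : (z1 - z2) * ((z1 + z2 / 2) ^+ 2 + 3 / 4 * z2 ^+ 2 + 3 * s ^+ 2) =
    z1 ^+ 3 + 3 * s ^+ 2 * z1 - (z2 ^+ 3 + 3 * s ^+ 2 * z2) by field.
  by rewrite c1 c2 subrr.
rewrite mulf_eq0 => /orP[//|]; rewrite gt_eqF//.
apply: ltr_wpDl; last by rewrite mulr_gt0// exprn_gt0.
by rewrite addr_ge0 ?sqr_ge0// mulr_ge0 ?sqr_ge0.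
Qed.

(** Once the denominator is cleared, the gap is the square of [q - price_m mu beta]. *)
Lemma mean_revenue_lt {R : realType} {mu beta q : R} :
  mu < beta -> 0 < beta -> q < beta -> q != price_m mu beta ->
  q * ((mu - q) / (beta - q)) < 2 * price_m mu beta - mu.
Proof.
rewrite /price_m => mub b0 qb; set D := Num.sqrt _ => qD.
have D2 : D ^+ 2 = beta * (beta - mu).
  by rewrite sqr_sqrtr// mulr_ge0 ?subr_ge0 ?ltW.
rewrite mulrA ltr_pdivrMr ?subr_gt0// -subr_gt0.
have -> : (2 * (beta - D) - mu) * (beta - q) - q * (mu - q) =
  (q - (beta - D)) ^+ 2 + (beta * (beta - mu) - D ^+ 2) by ring.
by rewrite D2 subrr addr0 exprn_even_gt0//= subr_eq0.
Qed.

Lemma mean_revenue_eq {R : realType} {mu beta : R} :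
  mu < beta -> 0 < beta ->
  price_m mu beta * ((mu - price_m mu beta) / (beta - price_m mu beta)) =
    2 * price_m mu beta - mu.
Proof.
rewrite /price_m => mub b0; set D := Num.sqrt _.
have D2 : D ^+ 2 = beta * (beta - mu).
  by rewrite sqr_sqrtr// mulr_ge0 ?subr_ge0 ?ltW.
have D0 : D != 0 by rewrite sqrtr_eq0 -ltNge mulr_gt0 ?subr_gt0.
rewrite subKr.
apply: (mulfI D0); rewrite mulrCA [D * (_ / D)]mulrC divfK//.
have -> : D * (2 * (beta - D) - mu) = (beta - D) * (mu - (beta - D)) +
  (beta * (beta - mu) - D ^+ 2) by ring.
by rewrite D2 subrr addr0.
Qed.

(** The lower bound makes the maximum [2 * price_m mu beta - mu] positive; the upper one lets the
    tail bounds apply at this price. *)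
Lemma price_m_bounds {R : realType} {mu beta : R} : 0 < mu -> mu < beta ->
  mu / 2 < price_m mu beta < mu.
Proof.
move=> mu0 mub; rewrite /price_m; set D := Num.sqrt _.
have b0 := lt_trans mu0 mub.
have D2 : D ^+ 2 = beta * (beta - mu).
  by rewrite sqr_sqrtr// mulr_ge0 ?subr_ge0 ?ltW.
have D0 : 0 <= D by exact: sqrtr_ge0.
apply/andP; split; nra.
Qed.

(** * From revenue bounds to optimal prices *)

Lemma optimal_prices_eq1 {R : realType} {mu slo shi beta p K : R} :
  (K%:E <= worst_revenue mu slo shi beta p)%E ->
  (forall q, q != p -> (worst_revenue mu slo shi beta q < K%:E)%E) ->
  optimal_prices mu slo shi beta = [set p].
Proof.
move=> Kp Kq; apply/seteqP; split => [q opt_q|_ -> q] /=.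
  apply/eqP; apply: contraT => /Kq.
  by rewrite ltNge (le_trans Kp (opt_q p)).
have [-> //|/Kq/ltW] := eqVneq q p; by move=> /le_trans; apply.
Qed.

Lemma worst_revenue_ge {R : realType} {mu slo shi beta p x : R} : 0 <= p ->
  (forall P, ambiguity mu slo shi beta P -> (x%:E <= P `[p, +oo[%classic)%E) ->
  ((p * x)%:E <= worst_revenue mu slo shi beta p)%E.
Proof.
move=> p0 xP; apply: le_ereal_inf_tmp => _ [P PA <-].
by rewrite EFinM lee_wpmul2l ?lee_fin ?xP.
Qed.

(** The cubic reads [z (z^2 + 3 s^2) = 2 mu s^2], which fixes the sign of [z]. *)
Lemma kappa_gt0 {R : realType} {mu s : R} :
  0 < mu -> 0 < s -> 0 < s * kappa mu s.
Proof.
move=> mu0 s0; have s20 : 0 < s ^+ 2 by rewrite exprn_gt0.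
rewrite -(pmulr_lgt0 _ (_ : 0 < (s * kappa mu s) ^+ 2 + 3 * s ^+ 2)).
  rewrite mulrDr [_ * (3 * _)]mulrC -exprS kappa_cubic ?gt_eqF//.
  by rewrite !mulr_gt0.
by rewrite ltr_wpDl ?sqr_ge0// mulr_gt0.
Qed.

(** Subtracting the cubics at [s] and [x] bounds the gap between the roots by a multiple of
    [s^2 - x^2], which permits a squeeze. *)
Lemma price_l_cvg_left {R : realType} {mu s : R} : 0 < mu -> 0 < s ->
  price_l mu x @[x --> s^'-] --> price_l mu s.
Proof.
move=> mu0 s0.
have zc := kappa_cubic (mu := mu) (lt0r_neq0 s0); have z0 := kappa_gt0 mu0 s0.
rewrite /price_l; set z := s * kappa mu s in zc z0 *.
have z20 : 0 < z ^+ 2 by rewrite exprn_gt0.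
(* Dividing by [z^2] alone, the other terms of the cofactor being nonnegative, keeps [C] independent
   of [x]. *)
pose C := (2 * mu - 3 * z) / z ^+ 2.
apply: (@squeeze_cvgr _ _ _ _ (fun=> mu - z)
    (fun x => mu - z + (s ^+ 2 - x ^+ 2) * C)).
- near=> x.
  have x0 : 0 < x by near: x; exact: nbhs_left_gt.
  have xs : x < s by near: x; exact: nbhs_left_lt.
  have wc := kappa_cubic (mu := mu) (lt0r_neq0 x0); have w0 := kappa_gt0 mu0 x0.
  set w := x * kappa mu x in wc w0 *.
  have wz : w < z by exact: cardano_root_lt x0 xs z0 wc zc.
  apply/andP; split; first by rewrite lerD2l lerN2 ltW.
  have diff : (z - w) * (z ^+ 2 + (z * w + w ^+ 2 + 3 * x ^+ 2)) =
      (s ^+ 2 - x ^+ 2) * (2 * mu - 3 * z).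
    have -> : (z - w) * (z ^+ 2 + (z * w + w ^+ 2 + 3 * x ^+ 2)) =
      z ^+ 3 + 3 * s ^+ 2 * z - (w ^+ 3 + 3 * x ^+ 2 * w) -
      3 * z * (s ^+ 2 - x ^+ 2) by ring.
    by rewrite zc wc; ring.
  have : (z - w) * z ^+ 2 <= (s ^+ 2 - x ^+ 2) * (2 * mu - 3 * z).
    rewrite -diff ler_wpM2l ?subr_ge0 ?(ltW wz)// lerDl.
    have zw : 0 <= z * w by rewrite mulr_ge0 ?ltW.
    by have := sqr_ge0 w; have := sqr_ge0 x; lra.
  by rewrite -ler_pdivlMr// -mulrA -/C; lra.
- exact: cvg_cst.
- rewrite -[X in _ --> X]addr0 -[X in _ --> _ + X](mul0r C) -(subrr (s ^+ 2)).
  apply: cvgD; first exact: cvg_cst.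
  apply: cvgM; last exact: cvg_cst.
  apply: cvgB; first exact: cvg_cst.
  by apply: cvg_at_left_filter; exact: exprn_continuous.
Unshelve. all: by end_near. Qed.

(** * The crossing deviation and the jump *)

Theorem theorem3p2 (R : realType) (mu beta : R)
    (mu_gt0 : 0 < mu) (mu_lt_beta : mu < beta) :
  exists2 s0 : R, 0 < s0 & forall slo : R, 0 <= slo -> slo < s0 ->
    exists s p' : R,
      [/\ slo < s /\ s < sigma_max mu beta,
          p' = price_m mu beta \/ p' = price_h mu slo beta,
          (forall shi : R, 0 < shi -> slo <= shi -> shi < s ->
             optimal_prices mu slo shi beta = [set price_l mu shi]),
          (forall shi : R, s < shi -> shi <= sigma_max mu beta ->
             optimal_prices mu slo shi beta = [set p'])
        & price_l mu x @[x --> s^'-] --> price_l mu s /\ price_l mu s < p'].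
Proof.
have beta_gt0 := lt_trans mu_gt0 mu_lt_beta.
have bmu : 0 < beta - mu by rewrite subr_gt0.
pose pm := price_m mu beta.
have /andP[pm_gt pm_lt] : mu / 2 < pm < mu by exact: price_m_bounds.
have pm0 : 0 < pm by apply: lt_trans pm_gt; rewrite divr_gt0.
pose M := 2 * pm - mu.
have M0 : 0 < M by rewrite /M; lra.
have M_mu : M < mu by rewrite /M; lra.
(* s is the deviation at which the maximum mu - 3 z / 2 of the Cantelli revenue
   equals the maximum M of the mean-only revenue. *)
pose z0 := 2 / 3 * (mu - M).
have z0_gt0 : 0 < z0 by rewrite mulr_gt0 ?divr_gt0// subr_gt0.
have z0_mu : z0 < mu by rewrite /z0; lra.
(* The cubic at [z0] is solved for [s^2], using [2 mu - 3 z0 = 2 M]. *)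
pose s := Num.sqrt (z0 ^+ 3 / (2 * M)).
have M2 : 0 < 2 * M by rewrite mulr_gt0.
have r0 : 0 < z0 ^+ 3 / (2 * M) by rewrite divr_gt0// exprn_gt0.
have s0 : 0 < s by rewrite sqrtr_gt0.
have s2 : s ^+ 2 * (2 * M) = z0 ^+ 3.
  by rewrite sqr_sqrtr ?divfK ?gt_eqF// ltW.
have z0cubic : z0 ^+ 3 + 3 * s ^+ 2 * z0 = 2 * mu * s ^+ 2.
  by rewrite -s2 /z0; field.
have MzE : mu - 3 / 2 * z0 = M by rewrite /z0; field.
have root_cubic x : 0 < x ->
    (x * kappa mu x) ^+ 3 + 3 * x ^+ 2 * (x * kappa mu x) = 2 * mu * x ^+ 2.
  by move=> x0; apply: kappa_cubic; rewrite gt_eqF.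
have root_gt0 x : 0 < x -> 0 < x * kappa mu x by exact: kappa_gt0.
have root_s : s * kappa mu s = z0.
  exact: cardano_root_inj s0 (root_cubic s s0) z0cubic.
have midM q : q < beta -> q != pm -> q * ((mu - q) / (beta - q)) < M.
  by move=> qb qpm; exact: mean_revenue_lt.
have midM_le q : q < beta -> q * ((mu - q) / (beta - q)) <= M.
  move=> qb; have [->|/(midM q qb)/ltW//] := eqVneq q pm.
  by rewrite mean_revenue_eq.
(* Otherwise the mean revenue at [mu - z0] would exceed the Cantelli revenue there, which equals
   [M], the maximum of the mean revenue. *)
have s_max2 : s ^+ 2 < mu * (beta - mu).
  rewrite ltNge; apply/negP => s_ge.
  have : (mu - z0) * (z0 ^+ 2 / (s ^+ 2 + z0 ^+ 2)) <
      (mu - z0) * (z0 / (beta - (mu - z0))).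
    rewrite ltr_pM2l ?subr_gt0// ltr_pdivrMr ?addr_gt0 ?exprn_gt0//.
    have bz : 0 < beta - (mu - z0) by lra.
    rewrite mulrAC ltr_pdivlMr//.
    rewrite expr2 -mulrA ltr_pM2l//; nra.
  rewrite (low_revenue_eq s0 z0cubic) MzE ltNge => /negP; apply.
  by have := midM_le (mu - z0); rewrite subKr; apply; lra.
have sigma_max2 : sigma_max mu beta ^+ 2 = mu * (beta - mu).
  by rewrite sqr_sqrtr// mulr_ge0// ltW.
have s_max : s < sigma_max mu beta.
  rewrite -(@ltr_pXn2r _ 2)// ?nnegrE ?sqrtr_ge0 ?(ltW s0)//.
  by rewrite sigma_max2.
(* For [slo >= 0], [slo < c] amounts to [beta (slo / (beta - mu))^2 < M]. *)
pose c := Num.sqrt (M / beta) * (beta - mu).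
have c0 : 0 < c by rewrite mulr_gt0// sqrtr_gt0 divr_gt0.
exists (Num.min s c); first by rewrite lt_min s0.
move=> slo slo0; rewrite lt_min => /andP[slo_s slo_c].
have sloM : beta * (slo / (beta - mu)) ^+ 2 < M.
  have Mb : 0 < M / beta by rewrite divr_gt0.
  rewrite mulrC -ltr_pdivlMr// -[ltRHS](sqr_sqrtr (ltW Mb)).
  rewrite ltr_pXn2r// ?nnegrE ?sqrtr_ge0 ?divr_ge0 ?(ltW bmu)//.
  by rewrite ltr_pdivrMr.
have shi_max2 shi : 0 < shi -> shi <= sigma_max mu beta ->
    shi ^+ 2 <= mu * (beta - mu).
  by move=> shi0 le_max; rewrite -sigma_max2 lerXn2r// nnegrE ?sqrtr_ge0 ?ltW.
exists s, pm; split => //.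
- by left.
- move=> shi shi0 slo_shi shi_s.
  pose z := shi * kappa mu shi.
  have z_gt0 : 0 < z by exact: root_gt0.
  have zc := root_cubic _ shi0; rewrite -/z in zc.
  have zz0 : z < z0 by exact: cardano_root_lt shi0 shi_s z0_gt0 zc z0cubic.
  have MK : M < mu - 3 / 2 * z by rewrite -MzE; lra.
  have pl0 : 0 < mu - z by rewrite subr_gt0 (lt_trans zz0).
  have pl_mu : mu - z < mu by rewrite gtrBl.
  (* Below [s] the threshold is the Cantelli maximum, which exceeds [M]. *)
  apply: (@optimal_prices_eq1 _ _ _ _ _ _ (mu - 3 / 2 * z)).
    rewrite -(low_revenue_eq shi0 zc).
    apply: worst_revenue_ge; first exact: ltW.
    move=> P /(ambiguity_tail_ge pl_mu mu_lt_beta shi0)[_].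
    by rewrite subKr.
  move=> q qpl; apply: worst_revenue_lt => //.
  + exact: shi_max2 (ltW (lt_trans shi_s s_max)).
  + exact: lt_trans MK.
  + exact: lt_trans MK.
  + move=> q0 qmu.
    have := @low_revenue_lt _ mu shi (mu - q) z shi0 z_gt0 zc.
    rewrite subKr subr_gt0; apply => //.
    by apply: contra_neq qpl => zq; rewrite /price_l -/z -zq subKr.
  + by move=> q0 qb; exact: le_lt_trans (midM_le q qb) MK.
- move=> shi s_shi shi_max.
  have shi0 := lt_trans s0 s_shi.
  pose z := shi * kappa mu shi.
  have z_gt0 : 0 < z by exact: root_gt0.
  have zc := root_cubic _ shi0; rewrite -/z in zc.
  have zz0 : z0 < z by exact: cardano_root_lt s0 s_shi z_gt0 z0cubic zc.
  have MK : mu - 3 / 2 * z < M by rewrite -MzE; lra.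
  (* Above [s] the threshold is [M], which exceeds the Cantelli maximum. *)
  apply: (@optimal_prices_eq1 _ _ _ _ _ _ M).
    rewrite /M -(mean_revenue_eq mu_lt_beta beta_gt0).
    apply: worst_revenue_ge; first exact: ltW.
    by move=> P /(ambiguity_tail_ge pm_lt mu_lt_beta shi0)[].
  move=> q qpm; apply: worst_revenue_lt => //.
  + exact: ltW (lt_trans slo_s s_shi).
  + exact: shi_max2.
  + move=> q0 qmu; apply: le_lt_trans MK.
    have [zq|zq] := eqVneq (mu - q) z.
      have -> : q = mu - z by rewrite -zq subKr.
      by rewrite subKr (low_revenue_eq shi0 zc).
    have := @low_revenue_lt _ mu shi (mu - q) z shi0 z_gt0 zc.
    by rewrite subKr subr_gt0 => /(_ qmu zq)/ltW.
  + by move=> q0 qb; exact: midM.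
- split; first exact: price_l_cvg_left.
  (* Here [mu - z0 = (4 pm - mu) / 3], which is below [pm] because [pm < mu]. *)
  by rewrite /price_l root_s /z0 /M; lra.
Qed.
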